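(* Let $K$ be a field, let $k,\ell,d$ be integers with $2\le k\le \ell\le d$, and let $I_0$ and $I_S$ (for $S\subseteq[k\ell]$) be the ideals of $R$ defined in the context. Then the ideals $I_0$ and $I_S$ are all prime.
   Context: Let $K$ be a field and $2\le k\le\ell\le d$ integers. Let $P=(p_{x,y})_{x\in[d],\,y\in[k\ell]}$ be a $d\times k\ell$ matrix of indeterminates and $R=K[P]$. For $A\subseteq[d]$, $B\subseteq[k\ell]$ with $|A|=|B|$, $[A|B]$ denotes the determinant of the submatrix of $P$ with rows indexed by $A$ and columns indexed by $B$ (in increasing order). For $j\in[\ell]$ let $C_j=\{(j-1)k+1,\dots,jk\}\subseteq[k\ell]$. Ideals of $R$: - $I_0=\langle [A|B] : A\subseteq[d],\ B\subseteq C_j \text{ for some } j\in[\ell],\ |A|=|B|=2\rangle+\langle [A|B]: A\subseteq[d],\ B\subseteq[k\ell],\ |A|=|B|=\ell\rangle$. - For every subset $S\subseteq[k\ell]$: $I_S=\langle p_{i,j}: i\in[d],\ j\in S\rangle+\langle [A|B] : A\subseteq[d],\ B\subseteq C_j \text{ for some } j\in[\ell],\ |A|=|B|=2\rangle$. *)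

(* Defs.v *)
From mathcomp Require Import all_boot all_order all_fingroup all_algebra.
From mathcomp Require Import boolp.
From mathcomp Require Import mpoly.

Set Implicit Arguments.
Unset Strict Implicit.
Unset Printing Implicit Defensive.

Import GRing.Theory.
Local Open Scope ring_scope.

Section Ideals.
Variable R : comNzRingType.

Definition ideal_gen (G : R -> Prop) : {pred R} :=
  [pred f | `[< exists n (c g : 'I_n -> R),
                  (forall i, G (g i)) /\ f = \sum_(i < n) c i * g i >]].

Definition ideal_add (I J : {pred R}) : {pred R} :=
  [pred f | `[< exists g h, [/\ g \in I, h \in J & f = g + h] >]].

(* [idealr_closed] includes that 1 is not in the ideal. *)
Definition prime_ideal (I : {pred R}) : Prop :=
  idealr_closed I /\ prime_idealr_closed I.

End Ideals.

(* [enum_val] lists a set of ordinals in increasing order. *)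
Definition minor (R : comNzRingType) (m n : nat) (M : 'M[R]_(m, n))
    (A : {set 'I_m}) (B : {set 'I_n}) (eqAB : #|A| = #|B|) : R :=
  \det (\matrix_(i < #|A|, j < #|A|)
          M (enum_val i) (enum_val (cast_ord eqAB j))).

Section IndeterminateMatrix.
Variables (K : fieldType) (d k l : nat).

(* The variables of the polynomial ring are indexed by the pairs (x, y)
   through the bijection [mxvec_index] from 'I_d * 'I_(k * l). *)
Definition polyring := {mpoly K[(d * (k * l))%N]}.

Definition indet_mx : 'M[polyring]_(d, k * l) :=
  \matrix_(x, y) 'X_(mxvec_index x y).

(* Columns are numbered from 0. *)
Definition block (j : 'I_l) : {set 'I_(k * l)} :=
  [set y : 'I_(k * l) | (j * k <= y < j.+1 * k)%N].

Definition block_2minor (f : polyring) : Prop :=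
  exists (A : {set 'I_d}) (B : {set 'I_(k * l)}) (eqAB : #|A| = #|B|)
    (j : 'I_l), [/\ #|A| = 2%N, B \subset block j & f = minor indet_mx eqAB].

Definition size_l_minor (f : polyring) : Prop :=
  exists (A : {set 'I_d}) (B : {set 'I_(k * l)}) (eqAB : #|A| = #|B|),
    #|A| = l /\ f = minor indet_mx eqAB.

Definition column_entry (S : {set 'I_(k * l)}) (f : polyring) : Prop :=
  exists (i : 'I_d) (j : 'I_(k * l)), j \in S /\ f = indet_mx i j.

Definition I0 : {pred polyring} :=
  ideal_add (ideal_gen block_2minor) (ideal_gen size_l_minor).

Definition IS (S : {set 'I_(k * l)}) : {pred polyring} :=
  ideal_add (ideal_gen (column_entry S)) (ideal_gen block_2minor).

End IndeterminateMatrix.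

Arguments I0 K d k l : clear implicits.
Arguments IS K d k l S : clear implicits.

(* Main.v *)
From HB Require Import structures.
Require Import Defs.
From mathcomp Require Import all_boot all_order all_fingroup all_algebra.
From mathcomp Require Import boolp.
From mathcomp Require Import mpoly.
From mathcomp Require Import ring zify.

Set Implicit Arguments.
Unset Strict Implicit.
Unset Printing Implicit Defensive.

Import GRing.Theory.
Local Open Scope ring_scope.

(** Each ideal is shown to be the kernel of a ring morphism into a polynomial
    ring over [K], which is a domain.

    Write [blk y] for the block of the column [y].  The morphism [segre], which
    sends the variable [p_(x,y)] to [a_(x, blk y) * b_y], has the ideal [I2] of
    the 2-minors inside the blocks as its kernel: it maps monomials to
    monomials, and two monomials with the same image differ by exchanges
    [p_(x,y1) p_(x1,y) -> p_(x,y) p_(x1,y1)] with [y] and [y1] in one block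
    ([segre_kernel_sub]).  Setting first the columns of [Z] to zero gives
    [IS Z].

    For [I0] the morphism [segre] is followed by [lowrank], which replaces
    [(a_(x,j))] by a generic matrix that kills a generic vector [v].  Such a
    matrix is singular, so the maximal minors go to zero.  Conversely let [f] be
    in the kernel.  Modulo the maximal minors [f] is a combination of monomials
    whose [a]-part is not divisible by any diagonal product
    [a_(x_0,0) ... a_(x_q,q)] with [x_0 < ... < x_q] ([mpoly_reducible]): a
    diagonal product is traded for the other terms of its minor, which lowers
    the exponent sum weighted by [x * j].  It remains to see that a nonzero [h]
    in [K[a,b]] with only diagonal-free monomials does not vanish under
    [lowrank] ([lowrank_diagonal_free]); then [segre f = 0] for the reduced
    [f], so that [f] is in [I2].

    For this last point a one-parameter degeneration is used.  Among the
    monomials of [h] of least degree in [a], let [mu0] be one of least weight,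
    where [a_(x,j)] has weight [(d - x) * j].  Reading the rows downwards, let a
    counter [stair] start at 0 and move from [j] to [j + 1], until it reaches
    [q], at each row [x] where [a_(x,j)] occurs in [mu0].  As [mu0] is
    diagonal-free, the column [q] does not occur where the counter stands at
    [q], so [a_(x, stair x)] occurs in [mu0] only if the counter moves at [x].
    There are monomials [v_j] in an
    extra variable [z] such that, row by row, the terms
    [a_(x,j) z^((d-x)j) v_j] have lowest order in [z] exactly at [j = stair x],
    and also at [stair x + 1] when the counter moves ([row_cost_min],
    [row_cost_tie]).  Solving each row equation for its entry in the column
    [stair x] yields a matrix over [K[a,b][z]] with kernel vector [v] whose
    other entries are free, and whose entry in the column [stair x] is, to
    lowest order, [a_(x,j) z^((d-x)j)] again if the counter moves and of higher
    order if not.  Up to a common scaling factor, evaluating [h] at this matrix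
    therefore gives, to lowest order, those terms of [h] of the same degree and
    weight as [mu0] that avoid the entries of higher order.  As [mu0] is one of
    them, the value is not zero, whereas it would be zero if [lowrank h] were
    ([lowrank_specialize]). *)

(** * Ideals and kernels *)

Section Ideals.
Variable R : comNzRingType.
Implicit Types (I J : {pred R}) (G : R -> Prop) (f g : R).

(** Ideals in the weak sense, where the unit ideal is allowed: [idealr_closed]
    would be a claim about 1 that is only available at the very end. *)
Definition ideal_like I :=
  [/\ 0 \in I, {in I &, forall f g, f + g \in I}
    & forall f, {in I, forall g, f * g \in I}].

Lemma ideal_like_opp I f : ideal_like I -> f \in I -> - f \in I.
Proof. by move=> [_ _ mulI] If; rewrite -mulN1r mulI. Qed.

Lemma ideal_like_sum I (T : Type) (r : seq T) (P : pred T) (F : T -> R) :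
  ideal_like I -> (forall i, P i -> F i \in I) -> \sum_(i <- r | P i) F i \in I.
Proof. by move=> [I0 addI _] IF; elim/big_ind: _. Qed.

Lemma ideal_like_gen G : ideal_like (ideal_gen G).
Proof.
split.
- apply/asboolP; exists 0%N, (fun=> 0), (fun=> 0).
  by split=> [[]//|]; rewrite big_ord0.
- move=> _ _ /asboolP[n1 [c1 [g1 [Gg1 ->]]]] /asboolP[n2 [c2 [g2 [Gg2 ->]]]].
  pose glue (h1 : 'I_n1 -> R) (h2 : 'I_n2 -> R) i :=
    match split i with inl j => h1 j | inr j => h2 j end.
  apply/asboolP; exists (n1 + n2)%N, (glue c1 c2), (glue g1 g2); split.
    by rewrite /glue => i; case: splitP.
  rewrite big_split_ord /=; congr (_ + _); apply: eq_bigr => i _; rewrite /glue.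
    by rewrite -[lshift _ _]/(unsplit (inl i)) unsplitK.
  by rewrite -[rshift _ _]/(unsplit (inr i)) unsplitK.
- move=> f _ /asboolP[n [c [g [Gg ->]]]].
  apply/asboolP; exists n, (fun i => f * c i), g; split=> //.
  by rewrite mulr_sumr; apply: eq_bigr => i _; rewrite mulrA.
Qed.

Lemma mem_ideal_gen G f : G f -> f \in ideal_gen G.
Proof.
move=> Gf; apply/asboolP; exists 1%N, (fun=> 1), (fun=> f).
by split=> //; rewrite big_ord1 mul1r.
Qed.

Lemma ideal_gen_sub G I : ideal_like I -> (forall f, G f -> f \in I) ->
  {subset ideal_gen G <= I}.
Proof.
move=> Iid GI _ /asboolP[n [c [g [Gg ->]]]]; apply: ideal_like_sum => // i _.
by have [_ _ mulI] := Iid; apply/mulI/GI.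
Qed.

Lemma ideal_like_add I J : ideal_like I -> ideal_like J ->
  ideal_like (ideal_add I J).
Proof.
move=> [I0 addI mulI] [J0 addJ mulJ]; split.
- by apply/asboolP; exists 0, 0; split=> //; rewrite addr0.
- move=> _ _ /asboolP[f1 [g1 [If1 Jg1 ->]]] /asboolP[f2 [g2 [If2 Jg2 ->]]].
  apply/asboolP; exists (f1 + f2), (g1 + g2).
  by split; rewrite ?addI ?addJ // addrACA.
- move=> f _ /asboolP[f1 [g1 [If1 Jg1 ->]]].
  apply/asboolP; exists (f * f1), (f * g1).
  by split; rewrite ?mulI ?mulJ // mulrDr.
Qed.

Lemma ideal_add_subl I J : ideal_like J -> {subset I <= ideal_add I J}.
Proof.
by move=> [J0 _ _] f If; apply/asboolP; exists f, 0; split; rewrite ?addr0.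
Qed.

Lemma ideal_add_subr I J : ideal_like I -> {subset J <= ideal_add I J}.
Proof.
by move=> [I0 _ _] f If; apply/asboolP; exists 0, f; split; rewrite ?add0r.
Qed.

Lemma ideal_add_sub I J H : ideal_like H -> {subset I <= H} ->
  {subset J <= H} -> {subset ideal_add I J <= H}.
Proof.
move=> [_ addH _] IH JH _ /asboolP[f [g [/IH Hf /JH Hg ->]]]; exact: addH.
Qed.

Variables (D : idomainType) (phi : {rmorphism R -> D}).

Definition kernel : {pred R} := [pred f | phi f == 0].

Lemma ideal_like_kernel : ideal_like kernel.
Proof.
split; rewrite ?inE ?rmorph0 //.
  by move=> f g; rewrite !inE rmorphD => /eqP-> /eqP->; rewrite addr0.
by move=> f g; rewrite !inE rmorphM => /eqP->; rewrite mulr0.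
Qed.

Lemma kernel_prime I : I =i kernel -> prime_ideal I.
Proof.
move=> I_ker; split; last first.
  by move=> f g; rewrite !I_ker !inE rmorphM mulf_eq0.
split; rewrite ?I_ker ?inE ?rmorph0 ?rmorph1 ?oner_eq0 //.
move=> f g h; rewrite !I_ker !inE rmorphD rmorphM => /eqP-> /eqP->.
by rewrite mulr0 addr0.
Qed.

End Ideals.

(** * Substitutions in polynomials *)

Lemma mpoly_rmorph_ext n (A : nzRingType) (B : nzRingType)
    (F G : {rmorphism {mpoly A[n]} -> B}) :
  (forall c, F c%:MP = G c%:MP) -> (forall i, F 'X_i = G 'X_i) -> F =1 G.
Proof.
move=> FG_C FG_X; elim/mpolyind => [|c m p _ _ IH]; first by rewrite !rmorph0.
rewrite !rmorphD IH -mul_mpolyC !rmorphM FG_C mpolyXE_id !rmorph_prod /=.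
by congr (_ * _ + _); apply: eq_bigr => i _; rewrite !rmorphXn /= FG_X.
Qed.

Section FinTypeVariables.
Variables (K : fieldType) (V : finType) (C : comNzRingType).
Variables (iota : {rmorphism K -> C}) (f : V -> C).

Definition pvar v : {mpoly K[#|V|]} := 'X_(enum_rank v).

Definition subst_var : {mpoly K[#|V|]} -> C := mmap iota (f \o enum_val).

HB.instance Definition _ := GRing.RMorphism.on subst_var.

Lemma subst_varE v : subst_var (pvar v) = f v.
Proof. by rewrite /subst_var mmapX mmap1U /= enum_rankK. Qed.

Lemma subst_varC c : subst_var c%:MP = iota c.
Proof. exact: mmapC. Qed.

End FinTypeVariables.

Section MatrixVariables.
Variables (K : fieldType) (d n : nat) (C : comNzRingType).
Variables (iota : {rmorphism K -> C}) (M : 'I_d -> 'I_n -> C).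

Definition subst_mx : {mpoly K[d * n]} -> C :=
  mmap iota (fun i => mxvec (\matrix_(x, y) M x y) 0 i).

HB.instance Definition _ := GRing.RMorphism.on subst_mx.

Lemma subst_mxE x y : subst_mx 'X_(mxvec_index x y) = M x y.
Proof. by rewrite /subst_mx mmapX mmap1U mxvecE mxE. Qed.

Lemma subst_mxC c : subst_mx c%:MP = iota c.
Proof. exact: mmapC. Qed.

End MatrixVariables.

(** * Products of generic rank-one blocks *)

Lemma mxvec_index_inj m n (x x' : 'I_m) (y y' : 'I_n) :
  mxvec_index x y = mxvec_index x' y' -> (x, y) = (x', y').
Proof. by move/cast_ord_inj/enum_rank_inj. Qed.

Lemma mnm_split_var n (m : 'X_{1..n}) i : (0 < m i)%N ->
  exists m', m = (U_(i) + m')%MM.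
Proof.
move=> m_gt0; exists (m - U_(i))%MM; rewrite addmC submK //.
by apply/mnm_lepP => j; rewrite mnm1E; case: eqP => // <-.
Qed.

Section Toric.
Variables (K : fieldType) (d n q : nat) (blk : 'I_n -> 'I_q.+1).
Local Notation R := {mpoly K[d * n]}.

(** Indices of the variables [a_(x,j)] and [b_y]. *)
Definition ab_index := ('I_d * 'I_q.+1 + 'I_n)%type.
Local Notation S := {mpoly K[#|{: ab_index}|]}.

Definition avar x j : S := pvar K (inl (x, j) : ab_index).
Definition bvar y : S := pvar K (inr y : ab_index).

Definition segre : R -> S :=
  subst_mx (@mpolyC #|{: ab_index}| K) (fun x y => avar x (blk y) * bvar y).

HB.instance Definition _ := GRing.RMorphism.on segre.

Definition segre_mnm1 (x : 'I_d) (y : 'I_n) : 'X_{1..#|{: ab_index}|} :=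
  (U_(enum_rank (inl (x, blk y) : ab_index))
   + U_(enum_rank (inr y : ab_index)))%MM.

Definition segre_mnm (m : 'X_{1..d * n}) : 'X_{1..#|{: ab_index}|} :=
  (\sum_(i < d * n)
     mxvec (\matrix_(x, y) segre_mnm1 x y) ord0 i *+ m i)%MM.

Lemma segreX m : segre 'X_[m] = 'X_[segre_mnm m].
Proof.
rewrite /segre /subst_mx mmapX /mmap1 /segre_mnm -mprodXE.
apply: eq_bigr => i _; rewrite -mpolyXn.
by case/mxvec_indexP: i => x y; rewrite !mxvecE !mxE mpolyXD.
Qed.

Lemma segre_mnmD m1 m2 :
  segre_mnm (m1 + m2)%MM = (segre_mnm m1 + segre_mnm m2)%MM.
Proof.
apply/mnmP => v; rewrite mnmDE !mnm_sumE -big_split /=; apply: eq_bigr => i _.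
by rewrite !mulmnE mnmDE mulnDr.
Qed.

Lemma segre_mnm_U x y : segre_mnm U_(mxvec_index x y) = segre_mnm1 x y.
Proof.
rewrite /segre_mnm (bigD1 (mxvec_index x y)) //= big1 => [|i ne_i].
  by rewrite mxvecE mxE mnm1E eqxx mulm1n Monoid.mulm1.
by rewrite mnm1E eq_sym (negPf ne_i) mulm0n.
Qed.

(** The support of an image monomial says which rows meet which blocks, and
    which columns occur, in the monomial it comes from; this is all that is
    needed to find exchanges and diagonals upstairs. *)
Lemma segre_mnm_gt0 m v :
  (0 < segre_mnm m (enum_rank v))%N <->
  exists x y, (0 < m (mxvec_index x y))%N /\ (v = inl (x, blk y) \/ v = inr y).
Proof.
have entry x y : (0 < segre_mnm1 x y (enum_rank v))%N <->
    v = inl (x, blk y) \/ v = inr y.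
  rewrite mnmDE !mnm1E !(inj_eq enum_rank_inj) addn_gt0 !lt0b.
  by split=> [/orP[]/eqP<-|[]->]; [left|right|rewrite eqxx|rewrite eqxx orbT].
rewrite mnm_sumE lt0n sum_nat_eq0 negb_forall; split.
  case/existsP=> i; rewrite /= -lt0n mulmnE muln_gt0.
  case/mxvec_indexP: i => x y; rewrite mxvecE mxE => /andP[/entry vxy mxy].
  by exists x, y.
case=> x [y [mxy /entry vxy]]; apply/existsP; exists (mxvec_index x y).
by rewrite /= -lt0n mulmnE mxvecE mxE muln_gt0 mxy vxy.
Qed.

Variable I : {pred R}.
Hypothesis I_ideal : ideal_like I.
Hypothesis I_2minors : forall x x' y y', blk y = blk y' ->
  'X_(mxvec_index x y) * 'X_(mxvec_index x' y')
  - 'X_(mxvec_index x y') * 'X_(mxvec_index x' y) \in I.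

(** If the image of [m] allows the variable [p_(x,y)], then [m] has a variable
    in the row [x] and the block of [y], and one in the column [y]; a single
    exchange between these two makes [p_(x,y)] appear. *)
Lemma segre_mnm_exchange m x y :
  (0 < segre_mnm m (enum_rank (inl (x, blk y) : ab_index)))%N ->
  (0 < segre_mnm m (enum_rank (inr y : ab_index)))%N ->
  exists m', [/\ segre_mnm (U_(mxvec_index x y) + m') = segre_mnm m
               & 'X_[m] - 'X_[U_(mxvec_index x y) + m'] \in I].
Proof.
have [I0 _ mulI] := I_ideal.
case/segre_mnm_gt0=> x0 [y1 [m_xy1 [[eq_x eq_blk]|//]]]; subst x0.
case/segre_mnm_gt0=> x1 [y0 [m_x1y [//|[eq_y]]]]; subst y0.
have [m_xy|] := posnP (m (mxvec_index x y)); last first.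
  by case/mnm_split_var=> m' ->; exists m'; rewrite subrr.
have [m1 def_m] := mnm_split_var m_xy1.
have m1_x1y : (0 < m1 (mxvec_index x1 y))%N.
  move: m_x1y; rewrite def_m mnmDE mnm1E.
  have [/mxvec_index_inj[_ eq_y]|//] := eqP.
  by move: m_xy1; rewrite eq_y m_xy.
have [m2 def_m1] := mnm_split_var m1_x1y.
exists (U_(mxvec_index x1 y1) + m2)%MM; rewrite def_m def_m1; split.
  rewrite !segre_mnmD !segre_mnm_U /segre_mnm1 eq_blk; apply/mnmP => v.
  by rewrite !mnmDE; lia.
rewrite !mpolyXD !mulrA -mulrBl mulrC; apply: mulI.
exact: I_2minors.
Qed.

(** A variable of [m'] can be produced in [m] by an exchange and then cancelled
    from both, so the degree drops. *)
Lemma segre_mnm_congr m m' :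
  segre_mnm m = segre_mnm m' -> 'X_[m] - 'X_[m'] \in I.
Proof.
have [I0 addI mulI] := I_ideal.
have [N] := ubnP (mdeg m'); elim: N m m' => // N IH m m' lt_m' eq_mm'.
have [m'0|] := eqVneq m' 0%MM.
  suff -> : m = 0%MM by rewrite m'0 subrr.
  apply/mnmP => i; rewrite mnm0E; apply/eqP; rewrite -leqn0 leqNgt; apply/negP.
  case/mxvec_indexP: i => x y m_xy.
  have: (0 < segre_mnm m (enum_rank (inr y : ab_index)))%N.
    by apply/segre_mnm_gt0; exists x, y; split=> //; right.
  by rewrite eq_mm' => /segre_mnm_gt0[x' [y' []]]; rewrite m'0 mnm0E.
rewrite -mdeg_eq0 mdegE -lt0n lt0n sum_nat_eq0 negb_forall => /existsP[i].
rewrite /= -lt0n; case/mxvec_indexP: i => x y m'_xy.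
have [||m1 [eq_m1 Im1]] := @segre_mnm_exchange m x y.
- by rewrite eq_mm'; apply/segre_mnm_gt0; exists x, y; split=> //; left.
- by rewrite eq_mm'; apply/segre_mnm_gt0; exists x, y; split=> //; right.
have [m2 def_m'] := mnm_split_var m'_xy.
rewrite -(subrKA 'X_[U_(mxvec_index x y) + m1]) addI //.
rewrite def_m' !mpolyXD -mulrBr mulI //; apply: IH.
  by move: lt_m'; rewrite def_m' mdegD mdeg1.
by move: eq_mm'; rewrite -eq_m1 def_m' !segre_mnmD => /addmI.
Qed.

Lemma segre_coef f mu : (segre f)@_mu =
  \sum_(m <- msupp f | segre_mnm m == mu) f@_m.
Proof.
rewrite {1}[f]mpolyE rmorph_sum raddf_sum [RHS]big_mkcond /=.
apply: eq_bigr => m _.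
rewrite -mul_mpolyC rmorphM /= /segre subst_mxC -/segre segreX mcoeffCM mcoeffX.
by case: eqP => _; rewrite ?mulr1 ?mulr0.
Qed.

(** In a kernel element the monomials with a given image have coefficients of
    sum zero, so every monomial has a partner with the same image; replacing it
    by the partner stays in the same class modulo [I] and shrinks the
    support. *)
Lemma segre_kernel_sub f : segre f = 0 -> f \in I.
Proof.
have [I0 addI mulI] := I_ideal.
have [N] := ubnP (size (msupp f)); elim: N f => // N IH f lt_f f_ker.
have [->//|f_neq0] := eqVneq f 0.
have [m f_m] : exists m, m \in msupp f.
  by move: f_neq0; rewrite -msupp_eq0; case: (msupp f) => // m s _;
    exists m; rewrite mem_head.
have [m' [f_m' ne_m eq_m]] : exists m', [/\ m' \in msupp f, m' != m
    & segre_mnm m = segre_mnm m'].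
  have := segre_coef f (segre_mnm m); rewrite f_ker mcoeff0.
  rewrite big_mkcond (bigD1_seq m) ?msupp_uniq //= eqxx.
  have [/hasP[m' f_m' /andP[ne /eqP eq]]|/hasPn none] :=
    boolP (has (fun m' => (m' != m) && (segre_mnm m' == segre_mnm m)) (msupp f)).
    by exists m'.
  rewrite big_seq_cond big1 => [|m' /andP[f_m' ne]].
    by move/esym/eqP; rewrite addr0 mcoeff_eq0 f_m.
  by move/(_ _ f_m'): none; rewrite ne; case: eqP.
have Idiff := segre_mnm_congr eq_m.
rewrite -[f](subrK (f@_m *: ('X_[m] - 'X_[m']))).
rewrite -mul_mpolyC addI ?mulI //; apply: IH; last first.
  rewrite rmorphB rmorphM /= rmorphB /= !segreX eq_m subrr mulr0 subr0.
  exact: f_ker.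
rewrite -ltnS; apply: leq_trans lt_f; rewrite ltnS.
have sub : {subset m :: msupp (f - (f@_m)%:MP * ('X_[m] - 'X_[m'])) <= msupp f}.
  move=> m1; rewrite inE => /predU1P[->//|].
  rewrite mcoeff_msupp mcoeffB mcoeffCM mcoeffB !mcoeffX.
  have [<-//|ne1] := eqVneq m m1.
  have [<-//|ne2] := eqVneq m' m1.
  by rewrite subrr mulr0 subr0 mcoeff_msupp.
apply: (uniq_leq_size _ sub); rewrite /= msupp_uniq andbT.
rewrite mcoeff_msupp negbK mcoeffB mcoeffCM mcoeffB !mcoeffX eqxx.
by rewrite (negPf ne_m) subr0 mulr1 subrr.
Qed.

End Toric.

(** * Rewriting modulo the maximal minors *)

(** The least non-fixed point is moved up, and its preimage lies above it. *)
Lemma perm_descent n (s : 'S_n) : s != 1%g ->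
  exists i j : 'I_n, (i < j)%N /\ (s j < s i)%N.
Proof.
move=> s_neq1; have /existsP[i0 s_i0] : [exists i, s i != i].
  apply: contraNT s_neq1; rewrite negb_exists => /forallP s_id.
  by apply/eqP/permP => i; rewrite perm1; apply/eqP/negbNE.
case: (@arg_minnP _ i0 (fun i => s i != i) (fun i => i : nat) s_i0) => i s_i min_i.
have fix_lt (k : 'I_n) : (k < i)%N -> s k = k.
  by move=> lt_k; apply/eqP; apply: contraTT lt_k; rewrite -leqNgt => /min_i.
exists i, (s^-1 i)%g; rewrite permKV; split; rewrite ltn_neqAle leqNgt.
  apply/andP; split.
    by apply: contraNneq s_i => /val_inj eq_i; rewrite {1}eq_i permKV.
  apply/negP=> lt_i; have := fix_lt _ lt_i; rewrite permKV => eq_i.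
  by move: lt_i; rewrite -eq_i ltnn.
apply/andP; split; first by rewrite eq_sym.
by apply/negP=> lt_i; move/eqP: s_i; apply; apply: (@perm_inj _ s); apply: fix_lt.
Qed.

(** Undoing a descent increases the sum, so only the identity can be a
    maximum. *)
Lemma perm_rearrangement n (x : 'I_n -> nat) (s : 'S_n) :
  (forall i j : 'I_n, (i < j)%N -> (x i < x j)%N) -> s != 1%g ->
  (\sum_i x i * s i < \sum_i x i * i)%N.
Proof.
move=> x_incr s_neq1; pose F (t : 'S_n) := (\sum_i x i * t i)%N.
have improve t : t != 1%g -> exists t', (F t < F t')%N.
  move=> /perm_descent[i [j [lt_ij lt_t]]]; exists (tperm i j * t)%g.
  have ne_ji : j != i by rewrite -val_eqE /= neq_ltn lt_ij orbT.
  rewrite /F (bigD1 i) // (bigD1 j) //= [ltnRHS](bigD1 i) // (bigD1 j) //=.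
  rewrite !permM tpermL tpermR.
  rewrite [X in (_ < _ + (_ + X))%N](eq_bigr (fun k => x k * t k)%N); last first.
    by move=> k /andP[ne_ki ne_kj]; rewrite permM tpermD // eq_sym.
  have := x_incr _ _ lt_ij; nia.
case: (@arg_maxnP _ s xpredT F isT) => t _ max_t.
have [t1|/improve[t' lt_t']] := eqVneq t 1%g; last first.
  by have := max_t t' isT; rewrite /= leqNgt lt_t'.
have -> : (\sum_i x i * i = F 1%g)%N by apply: eq_bigr => i _; rewrite perm1.
have [t' lt_t'] := improve _ s_neq1; rewrite -t1.
exact: leq_trans (max_t t' isT).
Qed.

Section Reduction.
Variables (K : fieldType) (d n q : nat) (blk : 'I_n -> 'I_q.+1).
Local Notation R := {mpoly K[d * n]}.

Definition diagonal_free (mu : 'X_{1..#|{: ab_index d n q}|}) :=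
  forall x : 'I_q.+1 -> 'I_d,
    (forall i j : 'I_q.+1, (i < j)%N -> (x i < x j)%N) ->
    exists i, mu (enum_rank (inl (x i, i) : ab_index d n q)) = 0%N.

Variable I : {pred R}.
Hypothesis I_ideal : ideal_like I.
Hypothesis I_minors : forall (x : 'I_q.+1 -> 'I_d) (y : 'I_q.+1 -> 'I_n),
  (forall i j : 'I_q.+1, (i < j)%N -> (x i < x j)%N) ->
  (forall i, blk (y i) = i) ->
  \det (\matrix_(i, j) 'X_(mxvec_index (x i) (y j)) : 'M[R]_q.+1) \in I.

Definition reducible_mod (f : R) := exists g, f - g \in I /\
  forall m, m \in msupp g -> diagonal_free (segre_mnm blk m).

Lemma reducible_modD f g :
  reducible_mod f -> reducible_mod g -> reducible_mod (f + g).
Proof.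
have [_ addI _] := I_ideal.
move=> [f' [If f'_red]] [g' [Ig g'_red]]; exists (f' + g').
rewrite opprD addrACA addI //; split=> // m.
by move/msuppD_le; rewrite mem_cat => /orP[/f'_red|/g'_red].
Qed.

Lemma reducible_mod_ideal f : f \in I -> reducible_mod f.
Proof. by exists 0; rewrite subr0 msupp0. Qed.

Lemma reducible_modZ c f : reducible_mod f -> reducible_mod (c *: f).
Proof.
have [_ _ mulI] := I_ideal.
move=> [g [Ig g_red]]; exists (c *: g); rewrite -scalerBr -mul_mpolyC mulI //.
by split=> // m /msuppZ_le/g_red.
Qed.

(** The weight for which the diagonal term is the heaviest term of a maximal
    minor, by the rearrangement inequality. *)
Definition mnm_weight (m : 'X_{1..d * n}) : nat :=
  (\sum_i mxvec (\matrix_(x < d, y < n) (x * blk y)%N) ord0 i * m i)%N.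

Lemma mnm_weightD m1 m2 :
  mnm_weight (m1 + m2)%MM = (mnm_weight m1 + mnm_weight m2)%N.
Proof.
by rewrite -big_split; apply: eq_bigr => i _; rewrite mnmDE mulnDr.
Qed.

Lemma mnm_weight_sum (x : 'I_q.+1 -> 'I_d) (y : 'I_q.+1 -> 'I_n) :
  mnm_weight (\sum_i U_(mxvec_index (x i) (y i)))%MM
  = (\sum_i x i * blk (y i))%N.
Proof.
have weight0 : mnm_weight 0%MM = 0%N.
  by rewrite /mnm_weight big1 // => i _; rewrite mnm0E muln0.
rewrite (big_morph _ mnm_weightD weight0); apply: eq_bigr => i _.
rewrite /mnm_weight (bigD1 (mxvec_index (x i) (y i))) //= big1 => [|j ne_j].
  by rewrite mxvecE mxE mnm1E eqxx muln1 addn0.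
by rewrite mnm1E eq_sym (negPf ne_j) muln0.
Qed.

(** A monomial whose image contains a diagonal is divisible by the diagonal
    term of a maximal minor with one column from each block; modulo the minor it
    becomes a combination of monomials of smaller weight. *)
Lemma monomial_reducible m : reducible_mod 'X_[m].
Proof.
have [_ _ mulI] := I_ideal.
have [N] := ubnP (mnm_weight m); elim: N m => // N IH m lt_m.
have [m_df|] := pselect (diagonal_free (segre_mnm blk m)).
  exists 'X_[m]; rewrite subrr; split=> [|m']; first by have [] := I_ideal.
  by rewrite msuppX inE => /eqP->.
move/existsNP=> [x /not_implyP[x_incr /forallNP m_diag]].
have /fin_all_exists[y y_m] : forall i, exists y,
    blk y = i /\ (0 < m (mxvec_index (x i) y))%N.
  move=> i; have /eqP := m_diag i; rewrite -lt0n => /segre_mnm_gt0.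
  by case=> x' [y [m_xy [[-> ->]|//]]]; exists y.
have y_blk i : blk (y i) = i by have [] := y_m i.
pose U (s : 'S_q.+1) := (\sum_i U_(mxvec_index (x i) (y (s i))))%MM.
have [m0 def_m] : exists m0, m = (m0 + U 1%g)%MM.
  (* The variables of the diagonal are distinct, as their columns lie in
     different blocks. *)
  exists (m - U 1%g)%MM; rewrite submK //; apply/mnm_lepP => i.
  rewrite mnm_sumE; case/mxvec_indexP: i => x' y'.
  have [i0 /eqP[<- <-]|none] := pickP (fun i => (x i, y i) == (x', y')).
    rewrite (bigD1 i0) //= big1 => [|i ne_i].
      by rewrite perm1 mnm1E eqxx addn0; have [] := y_m i0.
    rewrite mnm1E perm1; case: eqP => // /mxvec_index_inj[_ /(congr1 blk)].
    by rewrite !y_blk => eq_i; rewrite eq_i eqxx in ne_i.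
  rewrite big1 // => i _; rewrite mnm1E perm1.
  by case: eqP => // /mxvec_index_inj/eqP; rewrite none.
have weightU s : mnm_weight (U s) = (\sum_i x i * s i)%N.
  by rewrite /U mnm_weight_sum; apply: eq_bigr => i _; rewrite y_blk.
set D := \matrix_(i, j) 'X_(mxvec_index (x i) (y j)) : 'M[R]_q.+1.
have detD : \det D = \sum_(s : 'S_q.+1) (-1) ^+ s *: 'X_[U s].
  apply: eq_bigr => s _; rewrite scaler_sign -mulr_sign -mprodXE.
  by congr (_ * _); apply: eq_bigr => i _; rewrite mxE.
have -> : 'X_[m] = 'X_[m0] * \det D
    + \sum_(s : 'S_q.+1 | s != 1%g) (- (-1) ^+ s) *: 'X_[m0 + U s].
  rewrite detD (bigD1 1%g) //= odd_perm1 expr0 scale1r mulrDr -mpolyXD -def_m.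
  rewrite -addrA mulr_sumr -big_split big1 ?addr0 // => s _ /=.
  by rewrite mpolyXD scaleNr -scalerAr subrr.
apply: reducible_modD; first by apply/reducible_mod_ideal/mulI/I_minors.
have red0 : reducible_mod 0 by apply: reducible_mod_ideal; have [] := I_ideal.
apply: big_ind => // [|s s_neq1]; first exact: reducible_modD.
apply/reducible_modZ/IH; rewrite -ltnS; apply: leq_trans lt_m.
rewrite def_m !mnm_weightD ltnS ltn_add2l !weightU.
rewrite [ltnRHS](eq_bigr (fun i => x i * i)%N) => [|i _]; last by rewrite perm1.
exact: perm_rearrangement.
Qed.

Lemma mpoly_reducible f : reducible_mod f.
Proof.
elim/mpolyind: f => [|c m f _ _ f_red].
  by apply: reducible_mod_ideal; have [] := I_ideal.
by apply: reducible_modD f_red; apply/reducible_modZ/monomial_reducible.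
Qed.

End Reduction.

(** * Staircases and the costs of rows *)

Section Staircase.
Variables (d q : nat) (P : nat -> nat -> bool).

(** Read [P x j] as: the entry in row [x] and column [j] must be kept.  The
    value [stair x] is the length of the diagonal that a greedy search has found
    in the rows above [x], cut off at [q]; thus it is the next column to hit. *)
Fixpoint stair x : nat :=
  if x is x'.+1 then
    let s := stair x' in (s + (P x' s && (s < q)))%N
  else 0%N.

Definition step x := P x (stair x) && (stair x < q)%N.

Lemma stairS x : stair x.+1 = (stair x + step x)%N.
Proof. by []. Qed.

Lemma stair_mono x x' : (x <= x')%N -> (stair x <= stair x')%N.
Proof.
move/subnK<-; elim: (x' - x)%N => // k IH.
by rewrite addSn stairS (leq_trans IH) ?leq_addr.
Qed.

Lemma stair_le x : (stair x <= q)%N.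
Proof.
elim: x => // x IH; rewrite stairS /step; case: ltnP => [|_]; last first.
  by rewrite andbF addn0.
by case: P => /=; rewrite ?addn1 ?addn0.
Qed.

Lemma stair_hit x i : (i < stair x)%N ->
  exists x', [/\ (x' < x)%N, stair x' = i & P x' i].
Proof.
elim: x => // x IH; rewrite stairS.
have [/IH[x' [lt_x' <- Px']] _|le_i] := ltnP i (stair x).
  by exists x'; rewrite ltnS ltnW.
rewrite /step; case: andP => /= [[Px _]|_]; rewrite ?addn0 ?addn1 => lt_i.
  have <- : stair x = i by lia.
  by exists x.
by lia.
Qed.

Lemma step_inj x x' : step x -> step x' -> stair x = stair x' -> x = x'.
Proof.
wlog lt_x : x x' / (x < x')%N.
  by move=> wlog_lt sx sx' eq_s; case: (ltngtP x x') => // lt;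
    [apply: wlog_lt | symmetry; apply: wlog_lt].
by move=> sx _ eq_s; have := stair_mono lt_x; rewrite stairS sx; lia.
Qed.

(** The order in [z] of the coordinate [j] of the kernel vector.  It is chosen
    such that [row_cost x j], the order of the term of index [j] in the equation
    of the row [x], is a sum over all rows of terms that are each minimal at
    [j = stair x]. *)
Definition potential j := (\sum_(x < d) (stair x.+1 - j))%N.

Definition row_cost x j := ((d - x) * j + potential j)%N.

(** The factor [d - x] counts the rows from [x] on. *)
Lemma row_costE x j : row_cost x j =
  (\sum_(x' < d)
     (if x' < x then stair x'.+1 - j else maxn j (stair x'.+1)))%N.
Proof.
rewrite /row_cost.
have -> : ((d - x) * j = \sum_(x' < d) (if x' < x then 0 else j))%N.
  elim: d => [|e IH]; first by rewrite big_ord0.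
  rewrite big_ord_recr /= -IH; case: ltnP => le_e.
    have -> : (e.+1 - x = e - x)%N by lia.
    by rewrite addn0.
  by rewrite subSn // mulSn addnC.
rewrite -big_split; apply: eq_bigr => x' _; case: ltnP => _ //=.
by rewrite maxnE.
Qed.

(** The comparison holds term by term in [row_costE], because [stair] is
    monotone.  It is strict in the row before [x] if [j] is smaller than
    [stair x], and in the row [x] itself if [j] is larger than
    [stair x.+1]. *)
Lemma row_cost_min (x : 'I_d) j :
  j <> stair x -> ~~ (step x && (j == (stair x).+1)) ->
  (row_cost x (stair x) < row_cost x j)%N.
Proof.
move=> ne_j not_tie; rewrite !row_costE.
have le_term (x' : 'I_d) :
    ((if x' < x then stair x'.+1 - stair x else maxn (stair x) (stair x'.+1))
     <= (if x' < x then stair x'.+1 - j else maxn j (stair x'.+1)))%N.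
  by case: ltnP => [|/leqW] /stair_mono; lia.
suff [x0 lt_term] : exists x' : 'I_d,
    ((if x' < x then stair x'.+1 - stair x else maxn (stair x) (stair x'.+1))
     < (if x' < x then stair x'.+1 - j else maxn j (stair x'.+1)))%N.
  rewrite (bigD1 x0) // [ltnRHS](bigD1 x0) //= -addSn leq_add //.
  exact: leq_sum.
have [lt_j|ge_j] := ltnP j (stair x).
  have x_gt0 : (0 < x)%N by case: (x : nat) lt_j.
  have lt_p : (x.-1 < d)%N by rewrite (leq_ltn_trans (leq_pred _)).
  exists (Ordinal lt_p).
  have -> : (Ordinal lt_p : nat).+1 = x by rewrite /= prednK.
  by rewrite leqnn; lia.
exists x; rewrite ltnn stairS.
by case: (step x) not_tie; lia.
Qed.

Lemma row_cost_tie (x : 'I_d) :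
  step x -> row_cost x (stair x).+1 = row_cost x (stair x).
Proof.
move=> sx; rewrite !row_costE; apply: eq_bigr => x' _.
case: ltnP => [/stair_mono|le_x]; first by lia.
by have := stair_mono (le_x : (x < x'.+1)%N); rewrite stairS sx; lia.
Qed.

End Staircase.

(** * Lowest coefficients of polynomials *)

Section LowTerm.
Variable A : comNzRingType.
Implicit Types (c : A) (p : {poly A}).

(** The coefficient [c] may be zero: then [n] is only a lower bound for the
    order of [p]. *)
Definition low_term n c p := exists r, p = 'X^n * (c%:P + 'X * r).

Lemma low_termC c : low_term 0 c c%:P.
Proof. by exists 0; rewrite expr0 mul1r mulr0 addr0. Qed.

Lemma low_termX n : low_term n 1 'X^n.
Proof. by exists 0; rewrite mulr0 addr0 mulr1. Qed.

Lemma low_term_zero n : low_term n 0 0.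
Proof. by exists 0; rewrite mulr0 addr0 mulr0. Qed.

Lemma low_termM n1 n2 c1 c2 p1 p2 :
  low_term n1 c1 p1 -> low_term n2 c2 p2 ->
  low_term (n1 + n2) (c1 * c2) (p1 * p2).
Proof.
move=> [r1 ->] [r2 ->]; exists (c1%:P * r2 + r1 * c2%:P + 'X * r1 * r2).
by rewrite exprD polyCM; ring.
Qed.

Lemma low_termD n c1 c2 p1 p2 : low_term n c1 p1 -> low_term n c2 p2 ->
  low_term n (c1 + c2) (p1 + p2).
Proof. by move=> [r1 ->] [r2 ->]; exists (r1 + r2); rewrite polyCD; ring. Qed.

Lemma low_termN n c p : low_term n c p -> low_term n (- c) (- p).
Proof. by move=> [r ->]; exists (- r); rewrite polyCN; ring. Qed.

Lemma low_term_lt n n' c p : (n < n')%N -> low_term n' c p -> low_term n 0 p.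
Proof.
move=> /subnK<- [r ->]; exists ('X^(n' - n.+1) * (c%:P + 'X * r)).
by rewrite exprD exprS; ring.
Qed.

Lemma low_term_sum n (T : Type) (s : seq T) (Q : pred T) (c : T -> A)
    (p : T -> {poly A}) :
  (forall i, Q i -> low_term n (c i) (p i)) ->
  low_term n (\sum_(i <- s | Q i) c i) (\sum_(i <- s | Q i) p i).
Proof.
move=> low_p; elim/big_rec2: _ => [|i c' p' /low_p]; first exact: low_term_zero.
exact: low_termD.
Qed.

Lemma low_term_prod (T : Type) (s : seq T) (Q : pred T) (n : T -> nat)
    (c : T -> A) (p : T -> {poly A}) :
  (forall i, Q i -> low_term (n i) (c i) (p i)) ->
  low_term (\sum_(i <- s | Q i) n i) (\prod_(i <- s | Q i) c i)
    (\prod_(i <- s | Q i) p i).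
Proof.
move=> low_p; elim/big_rec3: _ => [|i p' c' n' /low_p]; first exact: low_termC.
exact: low_termM.
Qed.

Lemma low_term_exp n c p k :
  low_term n c p -> low_term (n * k) (c ^+ k) (p ^+ k).
Proof.
move=> low_p; elim: k => [|k IH]; first by rewrite muln0; exact: low_termC.
by rewrite mulnS !exprS; apply: low_termM.
Qed.

Lemma low_term0 n c : low_term n c 0 -> c = 0.
Proof.
move=> [r /(congr1 (fun p => p`_n))].
by rewrite coef0 coefXnM ltnn subnn coefD coefC coefXM eqxx addr0.
Qed.

End LowTerm.

(** * Matrices with a kernel vector *)

Section KernelVector.
Variables (K : fieldType) (d n q : nat).
Local Notation ab := (ab_index d n q).
Local Notation S := {mpoly K[#|{: ab}|]}.

Definition abv_index := (ab + 'I_q.+1)%type.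
Local Notation T := {mpoly K[#|{: abv_index}|]}.

Definition kvar j : T := pvar K (inr j : abv_index).

(** The generic matrix with kernel vector [v]: all columns but the last are
    free, and the last one is solved for, after scaling the matrix by the last
    coordinate of [v] to avoid the division. *)
Definition kernel_mx x j : T :=
  let a i := pvar K (inl (inl (x, i)) : abv_index) in
  if j == ord_max then - \sum_(i | i != ord_max) a i * kvar i
  else kvar ord_max * a j.

Lemma kernel_mxP x : \sum_j kernel_mx x j * kvar j = 0.
Proof.
rewrite (bigD1 ord_max) //= /kernel_mx eqxx mulNr mulr_suml addrC.
apply/eqP; rewrite subr_eq0; apply/eqP; apply: eq_bigr => j /negPf ->.
by rewrite -mulrA mulrC.
Qed.

Definition ab_value (C : Type) (M : 'I_d -> 'I_q.+1 -> C) (B : 'I_n -> C)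
  (v : ab) : C := match v with inl (x, j) => M x j | inr y => B y end.

Definition lowrank : S -> T := subst_var (@mpolyC #|{: abv_index}| K)
  (ab_value kernel_mx (fun y => pvar K (inl (inr y) : abv_index))).

HB.instance Definition _ := GRing.RMorphism.on lowrank.

(** Every matrix with a kernel vector is, up to the scaling by the last
    coordinate of that vector, a specialization of [kernel_mx]. *)
Lemma lowrank_specialize (C : comNzRingType) (iota : {rmorphism K -> C})
    (M : 'I_d -> 'I_q.+1 -> C) (v : 'I_q.+1 -> C) (B : 'I_n -> C) h :
  (forall x, \sum_j M x j * v j = 0) -> lowrank h = 0 ->
  subst_var iota (ab_value (fun x j => v ord_max * M x j) B) h = 0.
Proof.
move=> Mv0 h0.
pose E : {rmorphism T -> C} := subst_var iota (fun w : abv_index =>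
  match w with inl w' => ab_value M B w' | inr j => v j end).
have Evar w : E (pvar K w) = match w with
  inl w' => ab_value M B w' | inr j => v j end by exact: subst_varE.
suff -> : subst_var iota (ab_value (fun x j => v ord_max * M x j) B) h
          = E (lowrank h) by rewrite h0 rmorph0.
pose F : {rmorphism S -> C} := subst_var iota
  (ab_value (fun x j => v ord_max * M x j) B).
apply: (@mpoly_rmorph_ext _ _ _ F (E \o lowrank)) => [c|i] /=.
  by rewrite /F /lowrank /E !subst_varC.
rewrite -[i]enum_valK -/(pvar K _) /F /lowrank !subst_varE.
case: (enum_val i) => [[x j]|y] /=; last by rewrite Evar.
rewrite /kernel_mx; have [->|_] := eqVneq j ord_max; last first.
  by rewrite rmorphM !Evar.
rewrite rmorphN rmorph_sum.
under eq_bigr => k _ do rewrite rmorphM !Evar /=.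
have /eqP := Mv0 x; rewrite (bigD1 ord_max) //= addr_eq0 => /eqP <-.
by rewrite mulrC.
Qed.

(** * Degenerating a matrix with a kernel vector *)

Variable P : nat -> nat -> bool.
Local Notation stair := (stair q P).
Local Notation step := (step q P).
Local Notation a := (avar K n).

(** The lowest coefficients of the kernel vector.  At a row [x] where the
    staircase moves, two terms of the row equation are of lowest order; the
    factor indexed by [x] makes them cancel, and does not change the ratio of
    any other pair of consecutive coordinates ([kcoef_step]). *)
Definition kcoef (j : nat) : S :=
  \prod_(x < d | step x)
     (if (stair x < j)%N then - a x (inord (stair x))
      else a x (inord (stair x).+1)).

Lemma kcoef_step (x : 'I_d) : step x ->
  a x (inord (stair x)) * kcoef (stair x)
  + a x (inord (stair x).+1) * kcoef (stair x).+1 = 0.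
Proof.
move=> sx; rewrite /kcoef (bigD1 x) //= [X in _ + _ * X](bigD1 x) //=.
rewrite ltnn ltnSn.
rewrite [X in _ + _ * (_ * X)](eq_bigr (fun x' : 'I_d =>
  if (stair x' < stair x)%N then - a x' (inord (stair x'))
  else a x' (inord (stair x').+1))); first by ring.
move=> x' /andP[sx' ne_x']; rewrite ltnS leq_eqVlt.
case: eqP => //= eq_s; case/eqP: ne_x'.
exact/val_inj/(step_inj sx' sx).
Qed.

Lemma pvar_neq0 (V : finType) (v : V) : pvar K v != 0.
Proof.
by apply/eqP=> /(congr1 (mcoeff U_(enum_rank v))); rewrite mcoeffX eqxx mcoeff0
  => /eqP; rewrite oner_eq0.
Qed.

Lemma kcoef_neq0 j : kcoef j != 0.
Proof.
apply/prodf_neq0 => x _.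
by case: ifP => _; rewrite ?oppr_eq0 pvar_neq0.
Qed.

Local Notation C := {poly S}.

Definition kvec (j : 'I_q.+1) : C := (kcoef j)%:P * 'X^(potential d q P j).

(** The entry in the column [stair x] is solved for from the row equation.  The
    factor [\prod_i kvec i] clears the denominator [kvec (stair x)]; the factor
    ['X^N] makes the total degree dominate the weight when orders are
    compared. *)
Definition degenerate_mx N (x : 'I_d) (j : 'I_q.+1) : C :=
  let A i := (a x i)%:P * 'X^((d - x) * i) in
  let s := inord (stair x) in
  'X^N * (if j == s then
            - (\prod_(i | i != s) kvec i) * \sum_(i | i != s) A i * kvec i
          else A j * \prod_i kvec i).

Lemma degenerate_mxP N x : \sum_j degenerate_mx N x j * kvec j = 0.
Proof.
rewrite /degenerate_mx; set s := inord _; rewrite (bigD1 s) //= eqxx.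
rewrite [\prod_i kvec i](bigD1 s) //=; set E := \prod_(i | _) _.
set A := fun i : 'I_q.+1 => (a x i)%:P * 'X^((d - x) * i) : C.
rewrite [X in _ + X](eq_bigr (fun i => 'X^N * (kvec s * E) * (A i * kvec i))).
  by rewrite -mulr_sumr /A; ring.
by move=> i /negPf->; rewrite /A; ring.
Qed.

(** The entries of [degenerate_mx] that do not drop out to lowest order. *)
Definition visible (x : 'I_d) (j : 'I_q.+1) :=
  (j != stair x :> nat) || step x.

Definition scale_order N :=
  (N + potential d q P q + \sum_(i < q.+1) potential d q P i)%N.

Definition scale_coef : S := kcoef q * \prod_(i < q.+1) kcoef i.

Lemma low_term_kvec (j : 'I_q.+1) :
  low_term (potential d q P j) (kcoef j) (kvec j).
Proof.
rewrite -[X in low_term X]add0n -[X in low_term _ X]mulr1.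
exact: low_termM (low_termC _) (low_termX _ _).
Qed.

(** Only the entry in the column [stair x] needs an argument: in its row
    equation the other terms are of higher order, except the one in the next
    column when the staircase moves, and [kcoef_step] turns that one into the
    variable [a x (stair x)]. *)
Lemma low_term_degenerate N (x : 'I_d) (j : 'I_q.+1) :
  low_term (scale_order N + (d - x) * j)
    (scale_coef * (if visible x j then a x j else 0))
    (kvec ord_max * degenerate_mx N x j).
Proof.
have lowA (i : 'I_q.+1) :
    low_term ((d - x) * i) (a x i) ((a x i)%:P * 'X^((d - x) * i)).
  rewrite -[X in low_term X]add0n -[X in low_term _ X]mulr1.
  exact: low_termM (low_termC _) (low_termX _ _).
have s_le := stair_le q P x.
rewrite /degenerate_mx; set s := inord (stair x).
pose A (i : 'I_q.+1) : C := (a x i)%:P * 'X^((d - x) * i).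
have val_s : s = stair x :> nat by rewrite inordK.
have low_scale k c p : low_term k c p ->
    low_term (N + potential d q P q + k) (kcoef q * c)
      (kvec ord_max * ('X^N * p)).
  move=> low_p; rewrite -[c]mul1r [(N + _)%N]addnC -addnA.
  apply: low_termM (low_term_kvec _) (low_termM (low_termX _ _) low_p).
have [j_s|ne_j] := eqVneq j s; last first.
  have -> : visible x j by rewrite /visible -val_s ne_j.
  have -> : scale_coef * a x j = kcoef q * (a x j * \prod_(i < q.+1) kcoef i).
    by rewrite /scale_coef; ring.
  rewrite /scale_order -addnA [(\sum_(i < _) _ + _)%N]addnC.
  apply: low_scale; apply: low_termM (lowA _) _.
  by apply: low_term_prod => i _; apply: low_term_kvec.
rewrite {j}j_s.
have low_sum : low_term (row_cost d q P x s)
    (\sum_(i | i != s) (if step x && (i == (stair x).+1 :> nat)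
                        then a x i * kcoef i else 0))
    (\sum_(i | i != s) A i * kvec i).
  apply: low_term_sum => i ne_i.
  have low_i : low_term (row_cost d q P x i) (a x i * kcoef i) (A i * kvec i).
    exact: low_termM (lowA _) (low_term_kvec _).
  rewrite val_s; case: ifPn => [/andP[sx /eqP eq_i]|not_tie].
    by rewrite -(row_cost_tie sx) -eq_i.
  apply: low_term_lt low_i; apply: row_cost_min => //.
  by rewrite -val_s => /val_inj/eqP; rewrite (negPf ne_i).
have coef_sum : \sum_(i | i != s) (if step x && (i == (stair x).+1 :> nat)
    then a x i * kcoef i else 0)
    = - ((if visible x s then a x s else 0) * kcoef s).
  rewrite /visible val_s eqxx /=; have [sx|_] := boolP (step x); last first.
    by rewrite big1 ?mul0r ?oppr0.
  have lt_s : ((stair x).+1 < q.+1)%N by case/andP: sx.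
  have val_s1 : (inord (stair x).+1 : 'I_q.+1) = (stair x).+1 :> nat.
    by rewrite inordK.
  rewrite (bigD1 (inord (stair x).+1)) /=; last first.
    by rewrite -val_eqE /= val_s1 val_s; lia.
  rewrite big1 => [|i /andP[_ ne_i]]; last first.
    by rewrite -val_s1 val_eqE (negPf ne_i).
  rewrite val_s1 eqxx addr0; apply/eqP; rewrite -addr_eq0 addrC.
  exact/eqP/kcoef_step.
have -> : scale_coef * (if visible x s then a x s else 0)
    = kcoef q * (- \prod_(i | i != s) kcoef i
        * - ((if visible x s then a x s else 0) * kcoef s)).
  by rewrite /scale_coef (bigD1 s) //=; ring.
have -> : (scale_order N + (d - x) * s = N + potential d q P q
    + (\sum_(i < q.+1 | i != s) potential d q P i + row_cost d q P x s))%N.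
  rewrite /scale_order (bigD1 s) //= /row_cost; ring.
apply: low_scale; rewrite -coef_sum; apply: low_termM low_sum.
by apply/low_termN/low_term_prod => i _; apply: low_term_kvec.
Qed.

End KernelVector.

Section LowTermSubst.
Variables (K : fieldType) (V : finType) (A : comNzRingType).
Variables (iota : {rmorphism K -> {poly A}}) (f : V -> {poly A}).
Variables (ord : V -> nat) (coef : V -> A).

Lemma mpolyX_pvar (mu : 'X_{1..#|V|}) :
  'X_[mu] = \prod_v pvar K v ^+ mu (enum_rank v).
Proof.
by rewrite mpolyXE_id (reindex (@enum_rank V)) //; exact/onW_bij/enum_rank_bij.
Qed.

Lemma low_term_subst (mu : 'X_{1..#|V|}) :
  (forall v, low_term (ord v) (coef v) (f v)) ->
  low_term (\sum_v ord v * mu (enum_rank v))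
    (\prod_v coef v ^+ mu (enum_rank v)) (subst_var iota f 'X_[mu]).
Proof.
move=> low_f; rewrite mpolyX_pvar rmorph_prod; apply: low_term_prod => v _.
by rewrite rmorphXn /= subst_varE; apply: low_term_exp.
Qed.

End LowTermSubst.

(** * Diagonal-free polynomials and singular matrices *)

Section Faithful.
Variables (K : fieldType) (d n q : nat).
Local Notation ab := (ab_index d n q).
Local Notation S := {mpoly K[#|{: ab}|]}.
Implicit Types (h : S) (mu : 'X_{1..#|{: ab}|}).

Definition a_weight (v : ab) : nat :=
  if v is inl (x, j) then ((d - x) * j)%N else 0%N.

Definition a_degree (v : ab) : nat := if v is inl _ then 1%N else 0%N.

Definition mnm_sum (w : ab -> nat) mu := (\sum_v w v * mu (enum_rank v))%N.

Section LowestPart.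
Variables (P : nat -> nat -> bool) (N : nat) (h : S) (mu0 : 'X_{1..#|{: ab}|}).
Local Notation visible := (@visible d q P).
Local Notation order := (scale_order d q P N).
Local Notation deg := (mnm_sum a_degree).
Local Notation wt := (mnm_sum a_weight).

Definition visible_index (v : ab) :=
  if v is inl (x, j) then visible x j else true.

Hypothesis mu0_h : mu0 \in msupp h.
Hypothesis mu0_visible :
  forall v, (0 < mu0 (enum_rank v))%N -> visible_index v.
Hypothesis mu0_min : forall mu, mu \in msupp h ->
  (N * deg mu0 + wt mu0 <= N * deg mu + wt mu)%N.
Hypothesis wt_bound : forall mu, mu \in msupp h -> (wt mu < N)%N.

(** The substitution by [degenerate_mx] gives the monomial [mu] the order
    [order * deg mu + wt mu], where [order] is [N] plus an amount that
    depends on the staircase, hence on [mu0].  The minimality of [mu0] survives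
    this change: with factor [N], minimality already means least degree first
    and then least weight, since the weights are smaller than [N]. *)
Lemma scaled_order_min mu : mu \in msupp h ->
  (order * deg mu0 + wt mu0 <= order * deg mu + wt mu)%N
  /\ (order * deg mu0 + wt mu0 = order * deg mu + wt mu -> deg mu = deg mu0).
Proof.
move=> mu_h; have le_N : (N <= order)%N by rewrite /scale_order -addnA leq_addr.
have := mu0_min mu_h; have := wt_bound mu_h; have := wt_bound mu0_h.
by split; case: (ltngtP (deg mu) (deg mu0)); nia.
Qed.

(** In the value of [h] at [degenerate_mx], the coefficient of order [o] is a
    power of [scale_coef] times the sum of the terms of [h] of order [o] in
    which only visible variables occur, and the term of [mu0] is one of
    these. *)
Lemma lowrank_neq0 : lowrank h != 0.
Proof.
apply/eqP => h_ker; pose o := (order * deg mu0 + wt mu0)%N.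
pose iota : {rmorphism K -> {poly S}} := polyC \o @mpolyC #|{: ab}| K.
pose f := ab_value
  (fun x j => kvec K d n P ord_max * degenerate_mx K n P N x j)
  (fun y => (bvar K d q y)%:P).
pose shown (v : ab) : S := if visible_index v then pvar K v else 0.
pose gamma : S := scale_coef K d n q P.
have f_h0 : subst_var iota f h = 0.
  by apply: lowrank_specialize h_ker; apply: degenerate_mxP.
have low_f v : low_term (a_degree v * order + a_weight v)
    (gamma ^+ a_degree v * shown v) (f v).
  case: v => [[x j]|y]; rewrite /f /= ?mul1n ?expr1 ?mul0n ?expr0 ?mul1r.
    exact: low_term_degenerate.
  exact: low_termC.
pose part mu : S :=
  if (order * deg mu + wt mu == o)%N
  then \prod_v shown v ^+ mu (enum_rank v) else 0.
have low_mu mu : mu \in msupp h -> low_term o (gamma ^+ deg mu0 * part mu)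
    (subst_var iota f 'X_[mu]).
  move=> mu_h; have [le_o eq_deg] := scaled_order_min mu_h.
  have := low_term_subst iota mu low_f.
  set o' := (\sum_v _)%N; set c := \prod_v _.
  have -> : o' = (order * deg mu + wt mu)%N.
    rewrite /o' /mnm_sum big_distrr -big_split /=; apply: eq_bigr => v _.
    by ring.
  have -> : c = gamma ^+ deg mu * \prod_v shown v ^+ mu (enum_rank v).
    rewrite /c /mnm_sum expr_sum -big_split; apply: eq_bigr => v _ /=.
    by rewrite exprMn exprM.
  rewrite /part; case: eqP => [eq_o|ne_o].
    by rewrite eq_o eq_deg // -eq_o.
  rewrite mulr0; apply: low_term_lt.
  by rewrite ltn_neqAle le_o andbT; apply/eqP => /esym.
have : low_term o (\sum_(mu <- msupp h)
    (h@_mu)%:MP * (gamma ^+ deg mu0 * part mu)) 0.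
  rewrite -f_h0 [h in subst_var _ _ h]mpolyE rmorph_sum.
  rewrite big_seq [X in low_term _ _ X]big_seq.
  apply: low_term_sum => mu mu_h; rewrite -mul_mpolyC rmorphM /=.
  rewrite -[o]add0n subst_varC; apply: low_termM (low_mu mu mu_h).
  exact: low_termC.
move/low_term0 => sum0.
have {sum0} : gamma ^+ deg mu0 * \sum_(mu <- msupp h) h@_mu *: part mu == 0.
  rewrite mulr_sumr -[X in _ == X]sum0; apply/eqP/eq_bigr => mu _.
  by rewrite -mul_mpolyC mulrCA.
rewrite mulf_eq0 expf_eq0 /gamma /scale_coef mulf_eq0.
rewrite (negPf (kcoef_neq0 _ _ _ _ _ _)).
have /prodf_neq0/negPf -> : forall i : 'I_q.+1, true -> kcoef K d n q P i != 0.
  by move=> i _; apply: kcoef_neq0.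
rewrite andbF /= => /eqP/(congr1 (mcoeff mu0)); rewrite mcoeff0 raddf_sum /=.
have part_mu mu : part mu = (part mu)@_mu *: 'X_[mu].
  rewrite /part; case: ifP => _; last by rewrite mcoeff0 scale0r.
  have [/forallP vis|] := boolP [forall v : ab,
      (0 < mu (enum_rank v))%N ==> visible_index v].
    have -> : \prod_v shown v ^+ mu (enum_rank v) = 'X_[mu].
      rewrite mpolyX_pvar; apply: eq_bigr => v _; rewrite /shown.
      have := vis v; case: (visible_index v) => //.
      by rewrite implybF -eqn0Ngt => /eqP->; rewrite !expr0.
    by rewrite mcoeffX eqxx scale1r.
  rewrite negb_forall => /existsP[v]; rewrite negb_imply => /andP[mu_v hid].
  rewrite (bigD1 v) //= /shown (negPf hid) expr0n.
  by rewrite gtn_eqF // mul0r mcoeff0 scale0r.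
have part_mu0 : (part mu0)@_mu0 = 1.
  rewrite /part eqxx.
  have -> : \prod_v shown v ^+ mu0 (enum_rank v) = 'X_[mu0].
    rewrite mpolyX_pvar; apply: eq_bigr => v _; rewrite /shown.
    by have [->|/mu0_visible->//] := posnP (mu0 (enum_rank v)); rewrite !expr0.
  by rewrite mcoeffX eqxx.
rewrite (bigD1_seq mu0) ?msupp_uniq //= big1 => [|mu ne_mu].
  rewrite mcoeffZ part_mu0 mulr1 addr0 => /eqP.
  by rewrite mcoeff_eq0 mu0_h.
by rewrite part_mu !mcoeffZ mcoeffX (negPf ne_mu) !mulr0.
Qed.

End LowestPart.

(** The staircase is the one of the support of a lightest monomial [mu0].  If
    an entry of this support were not visible, the greedy search would stand at
    the column [q] and hit it once more, which completes a diagonal in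
    [mu0]. *)
Lemma lowrank_diagonal_free h :
  (forall mu, mu \in msupp h -> diagonal_free mu) -> lowrank h = 0 -> h = 0.
Proof.
move=> h_df h_ker; apply: contra_eq h_ker => h_neq0.
pose wt := mnm_sum a_weight; pose deg := mnm_sum a_degree.
(* The sum of all weights is a crude bound for each of them. *)
pose N := (\sum_(mu <- msupp h) wt mu).+1.
have wt_lt mu : mu \in msupp h -> (wt mu < N)%N.
  by move=> mu_h; rewrite ltnS (bigD1_seq mu) ?msupp_uniq //= leq_addr.
have ex_value : exists k, has (fun mu => N * deg mu + wt mu == k)%N (msupp h).
  have [mu mu_h] : exists mu, mu \in msupp h.
    case: (msupp h) (h_neq0) (msupp_eq0 h) => [|mu s] _; last first.
      by exists mu; rewrite mem_head.
    by move/esym/eqP => h0; rewrite h0 eqxx in h_neq0.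
  by exists (N * deg mu + wt mu)%N; apply/hasP; exists mu.
case: (ex_minnP ex_value) => k /hasP[mu0 mu0_h /eqP def_k] min_k.
pose P x j := [exists p : 'I_d * 'I_q.+1,
  [&& p.1 == x :> nat, p.2 == j :> nat & 0 < mu0 (enum_rank (inl p : ab))]]%N.
apply: (@lowrank_neq0 P N h mu0) => // [v mu0_v|mu mu_h]; last first.
  by rewrite def_k; apply: min_k; apply/hasP; exists mu.
case: v mu0_v => [[x j] mu0_xj|//] /=; rewrite /visible.
apply: contraT; rewrite negb_or negbK => /andP[/eqP j_stair no_step].
have Pxj : P x (stair q P x).
  by apply/existsP; exists (x, j); rewrite /= eqxx j_stair eqxx.
have stair_q : stair q P x = q.
  by move: no_step (stair_le q P x); rewrite /step Pxj /=; lia.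
have /fin_all_exists[y y_diag] : forall i : 'I_q.+1, exists y : 'I_d,
    stair q P y = i /\ P y i.
  move=> i; have [lt_i|ge_i] := ltnP i (stair q P x).
    have [x' [lt_x' eq_i Px']] := stair_hit lt_i.
    by exists (Ordinal (ltn_trans lt_x' (ltn_ord x))).
  by exists x; have -> : i = stair q P x :> nat by have := ltn_ord i; lia.
have y_incr (i j' : 'I_q.+1) : (i < j')%N -> (y i < y j')%N.
  have [eq_i _] := y_diag i; have [eq_j _] := y_diag j'.
  apply: contraTT; rewrite -!leqNgt => /(stair_mono q P).
  by rewrite eq_i eq_j.
have [i mu0_i] := h_df mu0 mu0_h y y_incr.
have [_ /existsP[[x' j'] /and3P[/eqP eq_x /eqP eq_j]]] := y_diag i.
have -> : x' = y i by apply: val_inj.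
have -> : j' = i by apply: val_inj.
by rewrite mu0_i.
Qed.

End Faithful.

(** * The ideals as kernels *)

Section Minors.

(** Both sides list the elements of [A] in increasing order. *)
Lemma enum_val_increasing m r (x : 'I_r -> 'I_m) (A : {set 'I_m})
    (cardA : #|A| = r) :
  (forall i j : 'I_r, (i < j)%N -> (x i < x j)%N) -> A = [set x i | i in 'I_r] ->
  forall i : 'I_#|A|, enum_val i = x (cast_ord cardA i).
Proof.
move=> x_incr defA i; pose lt_ord (u v : 'I_m) := (u < v)%N.
have sorted_ord p (s : 'I_p -> 'I_m) : {homo s : u v / (u < v)%N} ->
    sorted lt_ord (map s (enum 'I_p)).
  move=> s_incr; apply: (homo_sorted (e := fun u v : 'I_p => (u < v)%N)) => //.
  by have := iota_ltn_sorted 0 p; rewrite -val_enum_ord sorted_map.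
have enumA : enum A = map x (enum 'I_r).
  apply: (@irr_sorted_eq _ lt_ord) => [u v w|u|||u].
  - exact: ltn_trans.
  - exact: ltnn.
  - rewrite /enum_mem; apply: sorted_filter => [u v w|]; first exact: ltn_trans.
    by rewrite -enumT -[enum _]map_id; apply: sorted_ord.
  - exact: sorted_ord.
  - rewrite mem_enum defA.
    by apply/imsetP/mapP => [] [j _ ->]; exists j; rewrite ?mem_enum.
rewrite (enum_val_nth (x (cast_ord cardA i))) enumA.
rewrite (nth_map (cast_ord cardA i)) ?size_enum_ord -?cardA //.
by congr x; apply: val_inj; rewrite /= nth_enum_ord -?cardA.
Qed.

Lemma det_cast (A : comNzRingType) r r' (e : r' = r) (F : 'I_r -> 'I_r -> A) :
  \det (\matrix_(i < r', j < r') F (cast_ord e i) (cast_ord e j))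
  = \det (\matrix_(i < r, j < r) F i j).
Proof.
by subst r'; congr determinant; apply/matrixP => i j; rewrite !mxE !cast_ord_id.
Qed.

Lemma minor_increasing (A : comNzRingType) m n r (M : 'M[A]_(m, n))
    (x : 'I_r -> 'I_m) (y : 'I_r -> 'I_n) :
  (forall i j : 'I_r, (i < j)%N -> (x i < x j)%N) ->
  (forall i j : 'I_r, (i < j)%N -> (y i < y j)%N) ->
  exists (X : {set 'I_m}) (Y : {set 'I_n}) (eqXY : #|X| = #|Y|),
    [/\ #|X| = r, Y = [set y i | i in 'I_r]
      & \det (\matrix_(i, j) M (x i) (y j)) = minor M eqXY].
Proof.
have card_im p (z : 'I_r -> 'I_p) :
    (forall i j : 'I_r, (i < j)%N -> (z i < z j)%N) ->
    #|[set z i | i in 'I_r]| = r.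
  move=> z_incr; rewrite card_imset ?card_ord // => i j eq_z.
  apply: val_inj; case: (ltngtP i j) => // /z_incr; by rewrite eq_z ltnn.
move=> x_incr y_incr; have cX := card_im _ _ x_incr; have cY := card_im _ _ y_incr.
exists [set x i | i in 'I_r], [set y i | i in 'I_r], (etrans cX (esym cY)).
split=> //; rewrite /minor -(det_cast cX (fun i j => M (x i) (y j))).
congr determinant; apply/matrixP => i j; rewrite !mxE.
rewrite (enum_val_increasing cX x_incr) // (enum_val_increasing cY y_incr) //.
by congr (M _ (y _)); apply: val_inj.
Qed.

Lemma det_rank1 (A : comNzRingType) r (g h : 'I_r -> A) :
  r = 2%N -> \det (\matrix_(i, j) (g i * h j)) = 0.
Proof.
move=> r2; subst r; rewrite (expand_det_row _ ord0) !big_ord_recl big_ord0 /=.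
rewrite /cofactor !det_mx11 !mxE /=.
have -> : lift (lift ord0 ord0) ord0 = ord0 :> 'I_2 by apply: val_inj.
by rewrite expr0 expr1; ring.
Qed.

Lemma det_kernel (A : idomainType) r (M : 'M[A]_r) (v : 'cV[A]_r) :
  M *m v = 0 -> v != 0 -> \det M = 0.
Proof.
move=> Mv0; apply: contraNeq => det_neq0; apply/eqP/matrixP => i j.
have /matrixP/(_ i j) : \det M *: v = 0.
  by rewrite -mul_scalar_mx -mul_adj_mx -mulmxA Mv0 mulmx0.
rewrite !mxE => /eqP; rewrite mulf_eq0 (negPf det_neq0) /=.
by move/eqP.
Qed.

(** The matrix factors through the square matrix formed by the chosen rows of
    [kernel_mx], which is singular. *)
Lemma det_lowrank_columns (K : fieldType) d n q (y : 'I_n -> 'I_q.+1) r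
    (row : 'I_r -> 'I_d) (col : 'I_r -> 'I_n)
    (b : 'I_n -> {mpoly K[#|{: abv_index d n q}|]}) :
  r = q.+1 ->
  \det (\matrix_(i, j) (kernel_mx K n (row i) (y (col j)) * b (col j))) = 0.
Proof.
move=> r_q; subst r.
pose M := \matrix_(i, j) kernel_mx K n (row i) (j : 'I_q.+1).
pose Q := \matrix_(i < q.+1, j < q.+1) (if y (col j) == i then b (col j) else 0).
have -> : \matrix_(i, j) (kernel_mx K n (row i) (y (col j)) * b (col j)) = M *m Q.
  apply/matrixP => i j; rewrite !mxE (bigD1 (y (col j))) //= !mxE eqxx.
  rewrite big1 ?addr0 // => k /negPf ne_k.
  by rewrite !mxE eq_sym ne_k mulr0.
rewrite det_mulmx (@det_kernel _ _ M (\col_j kvar K d n j)) ?mul0r //.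
  apply/matrixP => i j; rewrite !mxE; apply: etrans (kernel_mxP K n q (row i)).
  by apply: eq_bigr => k _; rewrite !mxE.
apply/eqP => /matrixP/(_ ord0 ord0)/eqP; rewrite !mxE.
exact/negP/pvar_neq0.
Qed.

End Minors.

Lemma subst_congr (A : comNzRingType) n (I : {pred {mpoly A[n]}})
    (F : {rmorphism {mpoly A[n]} -> {mpoly A[n]}}) :
  ideal_like I -> (forall c, F c%:MP = c%:MP) ->
  (forall i, 'X_i - F 'X_i \in I) -> forall f, f - F f \in I.
Proof.
move=> [I0 addI mulI] F_C F_X.
have congrM f f' g g' :
    f - f' \in I -> g - g' \in I -> f * g - f' * g' \in I.
  move=> If Ig; have -> : f * g - f' * g' = g * (f - f') + f' * (g - g') by ring.
  by rewrite addI ?mulI.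
elim/mpolyind => [|c m f _ _ If]; first by rewrite rmorph0 subr0.
rewrite rmorphD opprD addrACA addI // -mul_mpolyC rmorphM /= F_C -mulrBr mulI //.
rewrite mpolyXE_id rmorph_prod.
apply: (big_ind2 (fun f f' => f - f' \in I)) => [||i _]; first by rewrite subrr.
  by move=> f1 f1' f2 f2'; apply: congrM.
rewrite rmorphXn /=; elim: (m i) => [|k IH]; first by rewrite subrr.
by rewrite !exprS; apply: congrM.
Qed.

Section Blocks.
Variables (K : fieldType) (d k q : nat).
Hypothesis k_gt0 : (0 < k)%N.
Local Notation n := (k * q.+1)%N.
Local Notation R := (polyring K d k q.+1).

Definition block_of (y : 'I_n) : 'I_q.+1 := inord (y %/ k).

Lemma block_of_val (y : 'I_n) : block_of y = (y %/ k)%N :> nat.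
Proof. by rewrite inordK // ltn_divLR //; case: y => y /=; rewrite mulnC. Qed.

Lemma mem_block (y : 'I_n) (j : 'I_q.+1) : (y \in block k j) = (block_of y == j).
Proof.
rewrite inE -val_eqE /= block_of_val eqn_leq andbC -leq_divRL //.
by rewrite -ltn_divLR // ltnS.
Qed.

(** Up to sign and up to trivial cases the rows and the columns may be taken in
    increasing order. *)
Lemma block_exchange x x' (y y' : 'I_n) : block_of y = block_of y' ->
  'X_(mxvec_index x y) * 'X_(mxvec_index x' y')
  - 'X_(mxvec_index x y') * 'X_(mxvec_index x' y)
    \in ideal_gen (@block_2minor K d k q.+1).
Proof.
have I2_ideal := ideal_like_gen (@block_2minor K d k q.+1).
have [I0 _ _] := I2_ideal.
have mem_opp := ideal_like_opp I2_ideal.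
wlog lt_x : x x' / (x < x')%N.
  move=> wlog_x eq_y; case: (ltngtP x x') => [lt_x|lt_x|/val_inj ->].
  - exact: wlog_x.
  - rewrite mulrC ['X_(mxvec_index x y') * _]mulrC -opprB mem_opp //.
    exact: wlog_x.
  - by rewrite mulrC subrr.
wlog lt_y : y y' / (y < y')%N.
  move=> wlog_y eq_y; case: (ltngtP y y') => [lt_y|lt_y|/val_inj ->].
  - exact: wlog_y.
  - by rewrite -opprB mem_opp //; apply: wlog_y.
  - by rewrite subrr.
move=> eq_y; pose two T (u v : T) (i : 'I_2) := if i == ord0 then u else v.
have two_incr m (u v : 'I_m) : (u < v)%N ->
    forall i j : 'I_2, (i < j)%N -> (two _ u v i < two _ u v j)%N.
  by move=> lt_uv [[|[|?]] ?] [[|[|?]] ?].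
have [A [B [eqAB [cA defB detE]]]] :=
  minor_increasing (indet_mx K d k q.+1) (two_incr _ _ _ lt_x) (two_incr _ _ _ lt_y).
apply: mem_ideal_gen; exists A, B, eqAB, (block_of y); split=> //.
  apply/subsetP => z; rewrite defB => /imsetP[i _ ->]; rewrite mem_block /two.
  by case: ifP => // _; rewrite eq_y.
rewrite -detE (expand_det_row _ ord0) !big_ord_recl big_ord0 /=.
rewrite /cofactor !det_mx11 !mxE /= /two /=.
by rewrite expr0 expr1; ring.
Qed.

Lemma block_2minor_kernel (D : idomainType) (phi : {rmorphism R -> D})
    (g : 'I_d -> 'I_q.+1 -> D) (h : 'I_n -> D) :
  (forall x y, phi 'X_(mxvec_index x y) = g x (block_of y) * h y) ->
  {subset ideal_gen (@block_2minor K d k q.+1) <= kernel phi}.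
Proof.
move=> phiX; apply: ideal_gen_sub; first exact: ideal_like_kernel.
move=> _ [A [B [eqAB [j [cA /subsetP sBj ->]]]]]; rewrite inE /minor -det_map_mx.
rewrite -(det_rank1 (fun i => g (enum_val i) j)
                    (fun i => h (enum_val (cast_ord eqAB i))) cA).
apply/eqP; congr determinant; apply/matrixP => i i'; rewrite !mxE phiX.
by have := sBj _ (enum_valP (cast_ord eqAB i')); rewrite mem_block => /eqP->.
Qed.

(** The kernel of [segre] after the columns of [Z] have been set to zero. *)
Lemma IS_prime (Z : {set 'I_n}) : prime_ideal (IS K d k q.+1 Z).
Proof.
pose clear : {rmorphism R -> R} := subst_mx (@mpolyC (d * n) K)
  (fun x y => if y \in Z then 0 else 'X_(mxvec_index x y)).
have clearX x y : clear 'X_(mxvec_index x y) =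
  if y \in Z then 0 else 'X_(mxvec_index x y) by exact: subst_mxE.
pose phi : {rmorphism R -> _} := @segre K d n q block_of \o clear.
have phiX x y : phi 'X_(mxvec_index x y)
    = avar K n x (block_of y) * (if y \in Z then 0 else bvar K d q y).
  rewrite /phi /= clearX; case: ifP => _; last by rewrite /segre subst_mxE.
  by rewrite rmorph0 mulr0.
apply: (kernel_prime (phi := phi)) => f; apply/idP/idP.
  apply: ideal_add_sub; first exact: ideal_like_kernel.
    apply: ideal_gen_sub; first exact: ideal_like_kernel.
    by move=> _ [x [y [Zy ->]]]; rewrite inE mxE phiX Zy mulr0.
  exact: block_2minor_kernel phiX.
rewrite inE => /eqP f_ker; rewrite -(subrK (clear f) f).
apply/asboolP; exists (f - clear f), (clear f); split=> //; last first.
  apply: (segre_kernel_sub (blk := block_of)) f_ker; first exact: ideal_like_gen.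
  exact: block_exchange.
apply: subst_congr => [|c|i]; first exact: ideal_like_gen.
  exact: subst_mxC.
case/mxvec_indexP: i => x y; rewrite clearX; case: ifP => [Zy|_].
  by rewrite subr0; apply: mem_ideal_gen; exists x, y; rewrite mxE.
by rewrite subrr; have [] := ideal_like_gen (@column_entry K d k q.+1 Z).
Qed.

(** The kernel of [lowrank] after [segre]: an element of it is congruent to a
    diagonal-free one, whose image under [segre] is zero because [lowrank] kills
    no diagonal-free polynomial. *)
Lemma I0_prime : prime_ideal (I0 K d k q.+1).
Proof.
pose phi : {rmorphism R -> _} := @lowrank K d n q \o @segre K d n q block_of.
pose b (y : 'I_n) := pvar K (inl (inr y) : abv_index d n q).
have phiX x y : phi 'X_(mxvec_index x y) = kernel_mx K n x (block_of y) * b y.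
  by rewrite /phi /= /segre subst_mxE rmorphM /= /lowrank /avar /bvar !subst_varE.
have I2_ideal := ideal_like_gen (@block_2minor K d k q.+1).
have Il_ideal := ideal_like_gen (@size_l_minor K d k q.+1).
have I0_ideal := ideal_like_add I2_ideal Il_ideal.
have I0_ker : {subset I0 K d k q.+1 <= kernel phi}.
  apply: ideal_add_sub; first exact: ideal_like_kernel.
    exact: block_2minor_kernel phiX.
  apply: ideal_gen_sub; first exact: ideal_like_kernel.
  move=> _ [A [B [eqAB [cA ->]]]]; rewrite inE /minor -det_map_mx; apply/eqP.
  rewrite -[RHS](det_lowrank_columns block_of enum_val
    (fun j => enum_val (cast_ord eqAB j)) b cA).
  by congr determinant; apply/matrixP => i j; rewrite !mxE phiX.
apply: (kernel_prime (phi := phi)) => f; apply/idP/idP; first exact: I0_ker.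
rewrite inE => /eqP f_ker.
have exch_I0 x x' y y' (eq_y : block_of y = block_of y') :=
  ideal_add_subl Il_ideal (block_exchange x x' eq_y).
have [|g [Ifg g_df]] := mpoly_reducible (blk := block_of) I0_ideal _ f.
  move=> x y x_incr y_blk.
  have y_incr (i j : 'I_q.+1) : (i < j)%N -> (y i < y j)%N.
    rewrite -{1}[i]y_blk -{1}[j]y_blk !block_of_val.
    by apply: contraTT; rewrite -!leqNgt; apply: leq_div2r.
  have [A [B [eqAB [cA _ detE]]]] :=
    minor_increasing (indet_mx K d k q.+1) x_incr y_incr.
  apply: ideal_add_subr => //; apply: mem_ideal_gen; exists A, B, eqAB; split=> //.
  rewrite -detE; congr determinant; apply/matrixP => i j; rewrite !mxE.
  by [].
have [_ addI _] := I0_ideal.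
rewrite -(subrK g f) addI //.
apply: (segre_kernel_sub I0_ideal exch_I0).
apply: lowrank_diagonal_free => [mu|].
  rewrite mcoeff_msupp segre_coef => sum_neq0.
  have /hasP[m g_m /eqP <-] :
      has (fun m => segre_mnm block_of m == mu) (msupp g).
    apply: contraNT sum_neq0 => /hasPn none; rewrite big_seq_cond big1 // => m.
    by case/andP=> /none /negPf->.
  exact: g_df.
by move/I0_ker: Ifg; rewrite inE rmorphB f_ker sub0r oppr_eq0 => /eqP.
Qed.

End Blocks.

Theorem theorem2p5 (K : fieldType) (k l d : nat)
    (k_ge2 : (2 <= k)%N) (le_kl : (k <= l)%N) (le_ld : (l <= d)%N) :
  prime_ideal (I0 K d k l) /\
  (forall S : {set 'I_(k * l)}, prime_ideal (IS K d k l S)).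
Proof.
have k_gt0 : (0 < k)%N by apply: ltnW.
case: l le_kl le_ld => [|q] le_kl _; first by case: k k_gt0 le_kl k_ge2.
by split=> [|S]; [apply: I0_prime | apply: IS_prime].
Qed.
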